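(* Let $a,b,c,n$ be (complex) parameters, and for $k\in\mathbb{N}_0$ set $$F(n,k) := \frac{(-1)^k (a)_{k+c}\,(b)_{k+c}}{(a+n)_k\,(b+n)_k},\qquad G(n,k) := R(n,k)\,F(n,k),\qquad \mathcal{F}(n) := \sum_{k=0}^{\infty}F(n,k),$$ where $R(n,k) = \frac{1}{(a+k+n)(b+k+n)}(a+n)(1+a+n)(b+n)(1+b+n)\big(2ab-c-ac-bc+c^2+2ak+2bk-2ck+2k^2+n+3an+3bn-4cn+6kn+5n^2\big)$. Assume that all the quantities $F(n,k)$, $F(n+2,k)$ ($k\in\mathbb{N}_0$) are defined, that the series $\mathcal{F}(n)$ and $\mathcal{F}(n+2)$ converge, and that $p_2(n)\neq 0$, where $p_1(n),p_2(n)$ are given below. Then $$\mathcal{F}(n) = g_1(n) + g_2(n)\,\mathcal{F}(n+2),\qquad g_1(n) = \frac{-G(n,0)}{p_2(n)},\quad g_2(n) = -\frac{p_1(n)}{p_2(n)},$$ where $p_1(n)$ and $p_2(n)$ are the following polynomials: $p_{1}(n) = a^2 c^2 - 2 a^2 c n + a^2 n^2 - 2 a b c^2 + 4 a b c n - 2 a b n^2 + b^2 c^2 - 2 b^2 c n + b^2 n^2 - c^4 + 4 c^3 n - 6 c^2 n^2 + 4 c n^3 - n^4 - a^2 c + a^2 n + 2 a b c - 2 a b n - b^2 c + b^2 n + 3 c^3 - 9 c^2 n + 9 c n^2 - 3 n^3 - 3 c^2 + 6 c n - 3 n^2 + c - n$, $p_{2}(n) = -4 a^2 b^2 - 8 a^2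 b n - 4 a^2 n^2 - 8 a b^2 n - 16 a b n^2 - 8 a n^3 - 4 b^2 n^2 - 8 b n^3 - 4 n^4 - 4 a^2 b - 4 a^2 n - 4 a b^2 - 16 a b n - 12 a n^2 - 4 b^2 n - 12 b n^2 - 8 n^3 - 4 a b - 4 a n - 4 n b - 4 n^2$.
   Context: The Pochhammer symbol is $(\alpha)_x = \Gamma(\alpha+x)/\Gamma(\alpha)$ (the index $x$ need not be an integer); for $x=k\in\mathbb{N}_0$ it is the rising factorial $(\alpha)_k=\alpha(\alpha+1)\cdots(\alpha+k-1)$, with $(\alpha)_0=1$. In $F(n+2,k)$ and $\mathcal{F}(n+2)$ the parameter $n$ is replaced by $n+2$ and $a,b,c$ are kept fixed. *)

(* Defs.v *)
(* Stdlib real numbers, with Coquelicot's complex numbers [C] and series. *)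
From Stdlib Require Import Reals Factorial ClassicalEpsilon.
From Coquelicot Require Import Coquelicot.

Open Scope C_scope.

Definition NtoC (k : nat) : C := RtoC (INR k).

Definition Cexp (z : C) : C :=
  (exp (Re z) * cos (Im z), exp (Re z) * sin (Im z))%R.

(* Limit and sum of a complex sequence, taken on real and imaginary parts; they
   are the usual ones whenever the sequence, resp. the series, converges in C. *)
Definition Clim_seq (u : nat -> C) : C :=
  (real (Lim_seq (fun m => Re (u m))), real (Lim_seq (fun m => Im (u m)))).

Definition CSeries (u : nat -> C) : C :=
  (Series (fun k => Re (u k)), Series (fun k => Im (u k))).

Fixpoint rising (al : C) (k : nat) : C :=
  match k with
  | O => 1
  | S j => rising al j * (al + NtoC j)
  end.

(* Euler-Gauss product: m! m^z / (z (z+1) ... (z+m)) -> Gamma(z) for every z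
   other than 0, -1, -2, ...; here m^z = exp (z ln m). *)
Definition Gamma (z : C) : C :=
  Clim_seq (fun m =>
    NtoC (fact m) * Cexp (z * RtoC (ln (INR m))) / rising z (S m)).

Definition is_Gamma_pole (z : C) : Prop := exists m : nat, z = - NtoC m.

(* Totalised value at a pole. Since / 0 = 0, this makes [_ / Gamma z] vanish
   there, in agreement with the entire function 1/Gamma. *)
Lemma Gamma_pole (z : C) : is_Gamma_pole z -> Gamma z = 0.
Proof.
intros [m ->].
assert (Cinv0 : / RtoC 0 = 0).
{ unfold Cinv, RtoC; simpl; f_equal; unfold Rdiv; ring. }
assert (H0 : forall j, rising (- NtoC m) (S (j + m)) = 0).
{ induction j as [|j IHj]; simpl in *.
  - ring.
  - rewrite IHj; ring. }
assert (Hu : forall j,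
  NtoC (fact (j + m)) * Cexp (- NtoC m * RtoC (ln (INR (j + m)))) /
    rising (- NtoC m) (S (j + m)) = 0).
{ intros j; rewrite H0; unfold Cdiv; rewrite Cinv0; ring. }
unfold Gamma, Clim_seq, RtoC; f_equal;
  rewrite <- (Lim_seq_incr_n _ m);
  rewrite (Lim_seq_ext _ (fun _ => 0%R));
  try (intros j; rewrite Hu; reflexivity);
  rewrite Lim_seq_const; reflexivity.
Qed.

(* (al)_x: the rising factorial when x is a natural number (also if al is a
   pole of Gamma), and Gamma(al+x)/Gamma(al) otherwise. *)
Definition pochhammer (al x : C) : C :=
  match excluded_middle_informative (exists k : nat, x = NtoC k) with
  | left Hx => rising al (proj1_sig (constructive_indefinite_description _ Hx))
  | right _ => Gamma (al + x) / Gamma al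
  end.

(* For x not a natural number, al itself may be a pole: (al)_x is then 0, by
   1/Gamma(al) = 0. *)
Definition pochhammer_defined (al x : C) : Prop :=
  (exists k : nat, x = NtoC k) \/ ~ is_Gamma_pole (al + x).

Lemma pochhammer_nat (al : C) (k : nat) : pochhammer al (NtoC k) = rising al k.
Proof.
unfold pochhammer.
destruct (excluded_middle_informative _) as [Hx|Hx].
- destruct (constructive_indefinite_description _ Hx) as [j Hj]; simpl.
  apply RtoC_inj, INR_eq in Hj; now subst j.
- exfalso; apply Hx; now exists k.
Qed.

Definition F (a b c n : C) (k : nat) : C :=
  (RtoC (-1) ^ k * pochhammer a (NtoC k + c) * pochhammer b (NtoC k + c)) /
  (pochhammer (a + n) (NtoC k) * pochhammer (b + n) (NtoC k)).

Definition F_defined (a b c n : C) (k : nat) : Prop :=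
  pochhammer_defined a (NtoC k + c) /\
  pochhammer_defined b (NtoC k + c) /\
  pochhammer (a + n) (NtoC k) <> 0 /\
  pochhammer (b + n) (NtoC k) <> 0.

Definition Rcert (a b c n k : C) : C :=
  1 / ((a + k + n) * (b + k + n)) *
  (a + n) * (1 + a + n) * (b + n) * (1 + b + n) *
  (2 * a * b - c - a * c - b * c + c ^ 2 + 2 * a * k + 2 * b * k - 2 * c * k
   + 2 * k ^ 2 + n + 3 * a * n + 3 * b * n - 4 * c * n + 6 * k * n
   + 5 * n ^ 2).

Definition G (a b c n : C) (k : nat) : C :=
  Rcert a b c n (NtoC k) * F a b c n k.

Definition Fsum (a b c n : C) : C := CSeries (F a b c n).

Definition p1 (a b c n : C) : C :=
  a ^ 2 * c ^ 2 - 2 * a ^ 2 * c * n + a ^ 2 * n ^ 2 - 2 * a * b * c ^ 2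
  + 4 * a * b * c * n - 2 * a * b * n ^ 2 + b ^ 2 * c ^ 2 - 2 * b ^ 2 * c * n
  + b ^ 2 * n ^ 2 - c ^ 4 + 4 * c ^ 3 * n - 6 * c ^ 2 * n ^ 2 + 4 * c * n ^ 3
  - n ^ 4 - a ^ 2 * c + a ^ 2 * n + 2 * a * b * c - 2 * a * b * n - b ^ 2 * c
  + b ^ 2 * n + 3 * c ^ 3 - 9 * c ^ 2 * n + 9 * c * n ^ 2 - 3 * n ^ 3
  - 3 * c ^ 2 + 6 * c * n - 3 * n ^ 2 + c - n.

Definition p2 (a b c n : C) : C :=
  - 4 * a ^ 2 * b ^ 2 - 8 * a ^ 2 * b * n - 4 * a ^ 2 * n ^ 2
  - 8 * a * b ^ 2 * n - 16 * a * b * n ^ 2 - 8 * a * n ^ 3 - 4 * b ^ 2 * n ^ 2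
  - 8 * b * n ^ 3 - 4 * n ^ 4 - 4 * a ^ 2 * b - 4 * a ^ 2 * n - 4 * a * b ^ 2
  - 16 * a * b * n - 12 * a * n ^ 2 - 4 * b ^ 2 * n - 12 * b * n ^ 2
  - 8 * n ^ 3 - 4 * a * b - 4 * a * n - 4 * n * b - 4 * n ^ 2.

Definition g1 (a b c n : C) : C := - G a b c n 0 / p2 a b c n.

Definition g2 (a b c n : C) : C := - (p1 a b c n / p2 a b c n).

(* Main.v *)
(* The pair (F, G) satisfies the Zeilberger-type relation
     p1(n) F(n+2,k) + p2(n) F(n,k) = G(n,k+1) - G(n,k),
   where p2(n) = -4 (a+n)(a+n+1)(b+n)(b+n+1).  After division by F(n,k) it is a
   polynomial identity.  Summing over k gives the theorem because R(n,k) has a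
   finite limit and F(n,k) -> 0, so that G(n,k) -> 0.

   The quotient F(n,k+1)/F(n,k) comes from (al)_{x+1} = (al)_x (al+x), which for
   non-integer x is Gamma(z+1) = z Gamma(z), and for x = -1 needs in addition
   Gamma(al) <> 0.  Both follow once the Euler-Gauss product is shown to converge
   to a nonzero limit: its successive quotients are 1 + O(1/m^2). *)
Require Import Defs.
From Stdlib Require Import Reals Lra Lia Factorial Classical ClassicalEpsilon.
From Coquelicot Require Import Coquelicot.
Open Scope C_scope.

(** * Limits of complex sequences *)

(** Componentwise like [Clim_seq], so that the limit rules reduce to those for real sequences. *)
Definition is_Clim (u : nat -> C) (l : C) : Prop :=
  is_lim_seq (fun m => Re (u m)) (Re l) /\ is_lim_seq (fun m => Im (u m)) (Im l).

Lemma is_Clim_unique (u : nat -> C) (l : C) : is_Clim u l -> Clim_seq u = l.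
Proof.
intros [Hr Hi]; unfold Clim_seq.
rewrite (is_lim_seq_unique _ _ Hr), (is_lim_seq_unique _ _ Hi).
now destruct l.
Qed.

Lemma is_Clim_eq (u : nat -> C) (l l' : C) : is_Clim u l -> is_Clim u l' -> l = l'.
Proof.
intros H H'.
now rewrite <- (is_Clim_unique _ _ H), <- (is_Clim_unique _ _ H').
Qed.

Lemma is_Clim_const (c : C) : is_Clim (fun _ => c) c.
Proof. split; apply is_lim_seq_const. Qed.

Lemma is_Clim_ext_loc (u v : nat -> C) (l : C) :
  eventually (fun m => u m = v m) -> is_Clim u l -> is_Clim v l.
Proof.
intros [N HN] [Hr Hi]; split;
  (eapply is_lim_seq_ext_loc; [|eassumption]);
  exists N; intros m Hm; simpl; now rewrite HN.
Qed.

Lemma is_Clim_ext (u v : nat -> C) (l : C) :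
  (forall m, u m = v m) -> is_Clim u l -> is_Clim v l.
Proof. intros H; apply is_Clim_ext_loc; exists 0%nat; intros; apply H. Qed.

Lemma is_Clim_plus (u v : nat -> C) (l l' : C) :
  is_Clim u l -> is_Clim v l' -> is_Clim (fun m => u m + v m) (l + l').
Proof.
intros [Hr Hi] [Hr' Hi']; split; simpl; now apply is_lim_seq_plus'.
Qed.

Lemma is_Clim_mult (u v : nat -> C) (l l' : C) :
  is_Clim u l -> is_Clim v l' -> is_Clim (fun m => u m * v m) (l * l').
Proof.
intros [Hr Hi] [Hr' Hi']; split; simpl.
- apply is_lim_seq_minus'; now apply is_lim_seq_mult'.
- apply is_lim_seq_plus'; now apply is_lim_seq_mult'.
Qed.

Lemma C_sqr_neq_0 (l : C) : l <> 0 -> (fst l ^ 2 + snd l ^ 2 <> 0)%R.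
Proof.
intros Hl H; apply Hl; destruct l as [x y]; simpl in H.
assert (x = 0%R) by nra; assert (y = 0%R) by nra; now subst.
Qed.

Lemma is_Clim_inv (u : nat -> C) (l : C) :
  l <> 0 -> is_Clim u l -> is_Clim (fun m => / u m) (/ l).
Proof.
intros Hl [Hr Hi].
pose proof (C_sqr_neq_0 l Hl).
assert (Hd : is_lim_seq (fun m => (fst (u m) ^ 2 + snd (u m) ^ 2)%R)
               (fst l ^ 2 + snd l ^ 2)%R).
{ apply is_lim_seq_plus'; simpl; apply is_lim_seq_mult';
    try (apply is_lim_seq_mult'; try apply is_lim_seq_const); assumption. }
split; unfold Cinv; simpl.
- now apply (is_lim_seq_div' _ _ _ _ Hr Hd).
- apply (is_lim_seq_div' _ _ (- Im l)%R); try assumption.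
  now apply (is_lim_seq_opp _ (Im l)).
Qed.

Lemma is_Clim_incr_n (u : nat -> C) (N : nat) (l : C) :
  is_Clim (fun m => u (m + N)%nat) l <-> is_Clim u l.
Proof.
unfold is_Clim.
rewrite <- (is_lim_seq_incr_n (fun m => Re (u m)) N),
        <- (is_lim_seq_incr_n (fun m => Im (u m)) N).
tauto.
Qed.

(** A ball of [C_UniformSpace] is a product of two real balls. *)
Lemma filterlim_is_Clim (u : nat -> C) (l : C) :
  filterlim u eventually (@locally C_UniformSpace l) -> is_Clim u l.
Proof.
intros H.
assert (H' := proj1 (filterlim_locally u l) H).
split; apply is_lim_seq_spec; intros eps;
  destruct (H' eps) as [N HN]; exists N; intros m Hm; apply (HN m Hm).
Qed.

(** * Convergence from telescoping bounds *)

Lemma is_lim_seq_inv_S : is_lim_seq (fun m => / INR (S m))%R 0.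
Proof.
apply (is_lim_seq_incr_1 (fun m => / INR m)%R).
apply (is_lim_seq_inv _ p_infty); [apply is_lim_seq_INR | discriminate].
Qed.

Lemma is_Clim_inv_S : is_Clim (fun m => / NtoC (S m)) 0.
Proof.
apply (is_Clim_ext (fun m => RtoC (/ INR (S m)))).
- intros m; apply RtoC_inv, not_0_INR; discriminate.
- split; [apply is_lim_seq_inv_S | apply is_lim_seq_const].
Qed.

(* [x j + B / (j+1)] is nonincreasing and bounded below. *)
Lemma ex_lim_of_telescoping (x : nat -> R) (B K : R) :
  (forall j, Rabs (x (S j) - x j) <= B * (/ INR (S j) - / INR (S (S j))))%R ->
  (forall j, Rabs (x j) <= K)%R -> exists l : R, is_lim_seq x l.
Proof.
intros Hx HK.
(* At index 0 the telescoping difference is 1/2, so [B / 2] bounds an absolute value. *)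
assert (HB : (0 <= B)%R).
{ pose proof (Hx 0%nat) as H; pose proof (Rabs_pos (x 1%nat - x 0%nat)).
  simpl in H; nra. }
destruct (ex_finite_lim_seq_decr (fun j => x j + B * / INR (S j))%R (- K)) as [l Hl].
- intros j; specialize (Hx j); apply Rabs_le_between in Hx; lra.
- intros j; specialize (HK j); apply Rabs_le_between in HK.
  assert (0 < / INR (S j))%R by (apply Rinv_0_lt_compat, lt_0_INR; lia).
  nra.
- exists l.
  apply (is_lim_seq_ext (fun j => (x j + B * / INR (S j)) - B * / INR (S j))%R);
    [intros; ring|].
  replace (Finite l) with (Finite (l - B * 0)%R) by (f_equal; ring).
  apply is_lim_seq_minus'; [exact Hl|].
  apply is_lim_seq_mult'; [apply is_lim_seq_const | apply is_lim_seq_inv_S].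
Qed.

Lemma im_le_Cmod (z : C) : (Rabs (Im z) <= Cmod z)%R.
Proof. eapply Rle_trans; [apply Rmax_r | apply Rmax_Cmod]. Qed.

Lemma Cmod_le_sum (x y : R) : (Cmod (x, y) <= Rabs x + Rabs y)%R.
Proof.
replace ((x, y) : C) with (RtoC x + RtoC y * Ci).
- eapply Rle_trans; [apply Cmod_triangle|].
  rewrite Cmod_mult, Cmod_Ci, !Cmod_R; lra.
- unfold RtoC, Ci, Cplus, Cmult; simpl; f_equal; ring.
Qed.

(* By induction and [1 + t <= exp t], [|w j| <= |w 0| exp (D (1 - 1/(j+1)))];
   the increments of [w] are then dominated by a telescoping series. *)
Lemma ex_Clim_of_summable_ratio (w : nat -> C) (D : R) :
  (0 <= D)%R ->
  (forall j, Cmod (w (S j) - w j) <=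
     D * (/ INR (S j) - / INR (S (S j))) * Cmod (w j))%R ->
  exists l, is_Clim w l.
Proof.
intros HD Hw.
set (t := fun j => (/ INR (S j))%R).
assert (Ht : forall j, (t (S j) <= t j)%R).
{ intros j; apply Rinv_le_contravar; [apply lt_0_INR; lia | apply le_INR; lia]. }
assert (Ht0 : forall j, (0 < t j)%R) by (intros j; apply Rinv_0_lt_compat, lt_0_INR; lia).
set (K := (Cmod (w 0%nat) * exp D)%R).
assert (Hexp : forall j, (Cmod (w j) <= Cmod (w 0%nat) * exp (D * (1 - t j)))%R).
{ induction j as [|j IH].
  - unfold t; simpl; rewrite Rinv_1.
    replace (D * (1 - 1))%R with 0%R by ring; rewrite exp_0; lra.
  - replace (D * (1 - t (S j)))%R with (D * (1 - t j) + D * (t j - t (S j)))%R by ring.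
    rewrite exp_plus.
    replace (w (S j)) with (w j + (w (S j) - w j)) by ring.
    eapply Rle_trans; [apply Cmod_triangle|].
    specialize (Hw j); fold (t j) (t (S j)) in Hw.
    pose proof (exp_ineq1_le (D * (t j - t (S j)))) as He.
    pose proof (Cmod_ge_0 (w j)).
    rewrite <- Rmult_assoc.
    apply Rle_trans with (Cmod (w j) * exp (D * (t j - t (S j))))%R; [nra|].
    apply Rmult_le_compat_r; [left; apply exp_pos | exact IH]. }
assert (HK : forall j, (Cmod (w j) <= K)%R).
{ intros j; eapply Rle_trans; [apply Hexp|]; unfold K.
  apply Rmult_le_compat_l; [apply Cmod_ge_0|].
  destruct (Req_dec (D * (1 - t j)) D) as [->|]; [lra|].
  left; apply exp_increasing; specialize (Ht0 j); nra. }
assert (Hd : forall j, (Cmod (w (S j) - w j) <= (D * K) * (t j - t (S j)))%R).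
{ intros j; eapply Rle_trans; [apply Hw|]; fold (t j) (t (S j)).
  specialize (HK j); specialize (Ht j); pose proof (Cmod_ge_0 (w j)).
  replace (D * K * (t j - t (S j)))%R with (D * (t j - t (S j)) * K)%R by ring.
  apply Rmult_le_compat_l; [|assumption].
  apply Rmult_le_pos; lra. }
destruct (ex_lim_of_telescoping (fun j => Re (w j)) (D * K) K) as [lr Hr].
- intros j; eapply Rle_trans; [|apply Hd].
  exact (re_le_Cmod (w (S j) - w j)).
- intros j; eapply Rle_trans; [apply re_le_Cmod | apply HK].
- destruct (ex_lim_of_telescoping (fun j => Im (w j)) (D * K) K) as [li Hi].
  + intros j; eapply Rle_trans; [|apply Hd].
    exact (im_le_Cmod (w (S j) - w j)).
  + intros j; eapply Rle_trans; [apply im_le_Cmod | apply HK].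
  + exists (lr, li); now split.
Qed.

(** * Second-order remainders of exp, sin and cos *)

(** Multiplying [1 - x <= exp (- x)] by [exp x] gives [exp x * (1 - x) <= 1], hence
    [(exp x - 1 - x) * (1 - x) <= x ^ 2], where [1 - x >= 1/2]. *)
Lemma exp_remainder (x : R) : (Rabs x <= / 2)%R -> (0 <= exp x - 1 - x <= 2 * x ^ 2)%R.
Proof.
intros Hx; apply Rabs_le_between in Hx.
pose proof (exp_ineq1_le x); pose proof (exp_ineq1_le (- x)).
assert (exp x * exp (- x) = 1)%R
  by (rewrite <- exp_plus, Rplus_opp_r; apply exp_0).
pose proof (exp_pos x).
assert (exp x * (1 - x) <= 1)%R by nra.
split; [lra|].
assert ((exp x - 1 - x) * (1 - x) <= x ^ 2)%R by nra.
nra.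
Qed.

Lemma Rabs_sin_le (x : R) : (Rabs (sin x) <= Rabs x)%R.
Proof.
assert (H : forall y, (0 <= y)%R -> (Rabs (sin y) <= y)%R).
{ intros y Hy; destruct (Rle_dec 1 y).
  - pose proof (SIN_bound y); apply Rabs_le; lra.
  - destruct (Req_dec y 0) as [->|]; [rewrite sin_0, Rabs_R0; lra|].
    pose proof (sin_lt_x y); pose proof PI2_1.
    pose proof (sin_ge_0 y); apply Rabs_le; lra. }
destruct (Rle_dec 0 x) as [Hx|Hx].
- rewrite (Rabs_pos_eq x Hx); now apply H.
- rewrite <- (Rabs_Ropp x), <- (Rabs_Ropp (sin x)), <- sin_neg.
  rewrite (Rabs_pos_eq (- x)) by lra; apply H; lra.
Qed.

Lemma sin_remainder (x : R) : (Rabs x <= 1)%R -> (Rabs (sin x - x) <= x ^ 2)%R.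
Proof.
assert (H : forall y, (0 <= y <= 1)%R -> (Rabs (sin y - y) <= y ^ 2)%R).
(* [sin_bound y 0] supplies the Taylor lower bound y - y^3/6; the upper side is sin y <= y. *)
{ intros y Hy; pose proof PI2_1; pose proof (sin_bound y 0) as Hs.
  pose proof (Rabs_sin_le y) as Ha; rewrite (Rabs_pos_eq y) in Ha by lra.
  apply Rabs_le_between in Ha.
  unfold sin_approx, sin_term in Hs; simpl in Hs.
  apply Rabs_le; split; [|nra].
  assert (y ^ 3 <= y ^ 2)%R by nra.
  lra. }
intros Hx; apply Rabs_le_between in Hx.
destruct (Rle_dec 0 x).
- apply H; lra.
- replace (sin x - x)%R with (- (sin (- x) - (- x)))%R by (rewrite sin_neg; ring).
  rewrite Rabs_Ropp; replace (x ^ 2)%R with ((- x) ^ 2)%R by ring; apply H; lra.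
Qed.

(** Uses cos x - 1 = -2 sin^2(x/2) and |sin(x/2)| <= |x/2|. *)
Lemma cos_remainder (x : R) : (Rabs (cos x - 1) <= x ^ 2 / 2)%R.
Proof.
replace x with (2 * (x / 2))%R at 1 by field.
rewrite cos_2a_sin.
pose proof (Rabs_sin_le (x / 2)) as H; apply Rsqr_le_abs_1 in H; unfold Rsqr in H.
apply Rabs_le; nra.
Qed.

Lemma Cexp_remainder (w : C) :
  (Cmod w <= / 2)%R -> (Cmod (Cexp w - 1 - w) <= 4 * Cmod w ^ 2)%R.
Proof.
intros Hw; rewrite Cmod2_alt.
pose proof (re_le_Cmod w) as Hx; pose proof (im_le_Cmod w) as Hy.
destruct w as [x y]; unfold Cexp; simpl Re in *; simpl Im in *.
(* Each component is split into the real remainders, plus the cross term y (exp x - 1), which is of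
   second order because |exp x - 1| <= 2 |x|. *)
replace ((exp x * cos y, exp x * sin y)%R - 1 - (x, y))
  with (((exp x * (cos y - 1) + (exp x - 1 - x))%R,
         (exp x * (sin y - y) + y * (exp x - 1))%R) : C)
  by (unfold Cminus, Cplus, Copp, RtoC; simpl; f_equal; ring).
eapply Rle_trans; [apply Cmod_le_sum|].
pose proof (exp_remainder x ltac:(lra)) as He.
pose proof (cos_remainder y) as Hc.
pose proof (sin_remainder y ltac:(lra)) as Hs.
assert (Hx2 : (Rabs x ^ 2 = x ^ 2)%R) by (apply pow2_abs).
assert (Hy2 : (Rabs y ^ 2 = y ^ 2)%R) by (apply pow2_abs).
pose proof (Rabs_pos x); pose proof (Rabs_pos y).
assert (exp x <= 2)%R by (pose proof (Rle_abs x); nra).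
pose proof (exp_pos x).
assert (Rabs (exp x - 1) <= 2 * Rabs x)%R.
{ replace (exp x - 1)%R with (x + (exp x - 1 - x))%R by ring.
  eapply Rle_trans; [apply Rabs_triang|].
  rewrite (Rabs_pos_eq (exp x - 1 - x)) by lra; nra. }
assert (Rabs (exp x * (cos y - 1) + (exp x - 1 - x)) <= y ^ 2 + 2 * x ^ 2)%R.
{ eapply Rle_trans; [apply Rabs_triang|].
  rewrite Rabs_mult, (Rabs_pos_eq (exp x)), (Rabs_pos_eq (exp x - 1 - x)) by lra.
  nra. }
assert (Rabs (exp x * (sin y - y) + y * (exp x - 1))
        <= 2 * y ^ 2 + 2 * Rabs x * Rabs y)%R.
{ eapply Rle_trans; [apply Rabs_triang|].
  rewrite !Rabs_mult, (Rabs_pos_eq (exp x)) by lra.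
  pose proof (Rabs_pos (sin y - y)); nra. }
(* The two bounds add up to 2x^2 + 3y^2 + 2|x||y|, and 2|x||y| <= x^2 + y^2. *)
pose proof (pow2_ge_0 (Rabs x - Rabs y)); nra.
Qed.

(** * Sequences with quotients 1 + O(1/m^2) *)

(** With x = j + 1 <= j + M, the right side is 2/(x(x+1)), and x + 1 <= 2x. *)
Lemma Rinv_sqr_le_telescope (j M : nat) :
  (1 <= M)%nat ->
  (/ INR (j + M) ^ 2 <= 2 * (/ INR (S j) - / INR (S (S j))))%R.
Proof.
intros HM.
assert (H1 : (INR (S j) <= INR (j + M))%R) by (apply le_INR; lia).
rewrite (S_INR (S j)).
assert (H0 : (1 <= INR (S j))%R) by (rewrite S_INR; pose proof (pos_INR j); lra).
set (x := INR (S j)) in *.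
apply Rle_trans with (/ x ^ 2)%R.
- apply Rinv_le_contravar; nra.
- replace (2 * (/ x - / (x + 1)))%R with (/ (x * (x + 1) / 2))%R by (field; lra).
  apply Rinv_le_contravar; nra.
Qed.

(* The same estimate holds for [/ u], which therefore converges as well; hence
   the limit of [u] is not 0. *)
Lemma ex_Clim_neq_0_of_ratio (u r : nat -> C) (K : R) (N : nat) :
  (forall m, u m <> 0) ->
  (forall m, (N <= m)%nat -> u (S m) = u m * r m) ->
  (forall m, (N <= m)%nat -> Cmod (r m - 1) <= K * / INR m ^ 2)%R ->
  exists l : C, l <> 0 /\ is_Clim u l.
Proof.
intros Hu Hur Hr.
destruct (INR_unbounded (2 * K + 1)) as [N' HN'].
(* Beyond [N'] the bound K/m^2 is at most 1/2, which keeps |r m| >= 1/2; the extra 1 ensures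
   [1 <= M]. *)
set (M := (N + N' + 1)%nat).
assert (HK : (0 <= K)%R).
{ specialize (Hr (S N) ltac:(lia)); pose proof (Cmod_ge_0 (r (S N) - 1)).
  assert (0 < / INR (S N) ^ 2)%R
    by (apply Rinv_0_lt_compat, pow_lt, lt_0_INR; lia).
  nra. }
assert (Hb : forall j, (Cmod (r (j + M)%nat - 1) <=
                 2 * K * (/ INR (S j) - / INR (S (S j))))%R).
{ intros j; eapply Rle_trans; [apply Hr; lia|].
  pose proof (Rinv_sqr_le_telescope j M ltac:(lia)); nra. }
assert (Hhalf : forall j, (/ 2 <= Cmod (r (j + M)%nat))%R).
{ intros j.
  assert (Hs : (Cmod (r (j + M)%nat - 1) <= / 2)%R).
  { eapply Rle_trans; [apply Hr; lia|].
    assert (H : (2 * K + 1 <= INR (j + M))%R).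
    { apply Rle_trans with (INR N'); [lra | apply le_INR; lia]. }
    set (x := INR (j + M)) in *.
    apply Rmult_le_reg_r with (x ^ 2)%R; [nra|].
    rewrite Rmult_assoc, Rinv_l by nra; nra. }
  pose proof (Cmod_triangle (r (j + M)%nat) (- (r (j + M)%nat - 1))) as Ht.
  rewrite Cmod_opp in Ht.
  replace (r (j + M)%nat + - (r (j + M)%nat - 1)) with (RtoC 1) in Ht by ring.
  rewrite Cmod_1 in Ht; lra. }
assert (Hr0 : forall j, r (j + M)%nat <> 0).
{ intros j H; specialize (Hhalf j); rewrite H, Cmod_0 in Hhalf; lra. }
destruct (ex_Clim_of_summable_ratio (fun j => u (j + M)%nat) (2 * K)) as [l Hl].
{ lra. }
{ intros j; cbv beta; rewrite Nat.add_succ_l,  (Hur (j + M)%nat) by lia.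
  replace (u (j + M)%nat * r (j + M)%nat - u (j + M)%nat)
    with ((r (j + M)%nat - 1) * u (j + M)%nat) by ring.
  rewrite Cmod_mult; apply Rmult_le_compat_r; [apply Cmod_ge_0 | apply Hb]. }
(* The constant doubles: 1/(u r) - 1/u = -(r - 1)/(r u), and 1/|r| <= 2. *)
destruct (ex_Clim_of_summable_ratio (fun j => / u (j + M)%nat) (4 * K)) as [l' Hl'].
{ lra. }
{ intros j; cbv beta; rewrite Nat.add_succ_l,  (Hur (j + M)%nat) by lia.
  replace (/ (u (j + M)%nat * r (j + M)%nat) - / u (j + M)%nat)
    with (- (r (j + M)%nat - 1) * / r (j + M)%nat * / u (j + M)%nat)
    by (field; split; auto).
  rewrite 2!Cmod_mult, Cmod_opp; apply Rmult_le_compat_r; [apply Cmod_ge_0|].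
  rewrite Cmod_inv by auto.
  assert (H2 : (/ Cmod (r (j + M)%nat) <= 2)%R).
  { rewrite <- (Rinv_inv 2); apply Rinv_le_contravar; [lra | apply Hhalf]. }
  specialize (Hb j); pose proof (Cmod_ge_0 (r (j + M)%nat - 1)); nra. }
exists l; split.
(* If the limit were 0, the constant sequence 1 = u (1/u) would tend to 0. *)
- intros ->.
  apply C1_nz, (is_Clim_eq (fun _ => RtoC 1)); [apply is_Clim_const|].
  rewrite <- (Cmult_0_l l').
  eapply is_Clim_ext; [|exact (is_Clim_mult _ _ _ _ Hl Hl')].
  intros j; simpl; field; auto.
- now apply (is_Clim_incr_n u M).
Qed.

(** * Rising factorials away from the poles of Gamma *)

Lemma NtoC_S (m : nat) : NtoC (S m) = NtoC m + 1.
Proof. unfold NtoC; now rewrite S_INR, RtoC_plus. Qed.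

Lemma NtoC_S_neq_0 (m : nat) : NtoC (S m) <> 0.
Proof. intros H; apply RtoC_inj in H; revert H; apply not_0_INR; discriminate. Qed.

Lemma not_pole_neq (z : C) (m : nat) : ~ is_Gamma_pole z -> z + NtoC m <> 0.
Proof.
intros Hz H; apply Hz; exists m.
replace z with (z + NtoC m - NtoC m) by ring; rewrite H; ring.
Qed.

Lemma rising_neq_0 (z : C) (m : nat) : ~ is_Gamma_pole z -> rising z m <> 0.
Proof.
intros Hz; induction m as [|m IH]; simpl; [apply C1_nz|].
apply Cmult_neq_0; [exact IH | now apply not_pole_neq].
Qed.

(** Peels off the first factor, whereas the recursion of [rising] peels off the last. *)
Lemma rising_shift (z : C) (m : nat) : z * rising (z + 1) m = rising z (S m).
Proof.
induction m as [|m IH].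
- simpl; unfold NtoC; simpl; ring.
- change (rising z (S (S m))) with (rising z (S m) * (z + NtoC (S m))).
  rewrite <- IH, NtoC_S; simpl; ring.
Qed.

Lemma not_pole_succ (z : C) : ~ is_Gamma_pole z -> ~ is_Gamma_pole (z + 1).
Proof.
intros Hz [m Hm]; apply (not_pole_neq z (S m) Hz).
rewrite NtoC_S; replace (z + (NtoC m + 1)) with (z + 1 + NtoC m) by ring.
rewrite Hm; ring.
Qed.

(** * The complex exponential and the Euler-Gauss product *)

Lemma Cexp_plus (z w : C) : Cexp (z + w) = Cexp z * Cexp w.
Proof.
unfold Cexp; rewrite re_plus, exp_plus; destruct z as [x y], w as [x' y'].
unfold Cplus, Cmult; simpl; rewrite cos_plus, sin_plus; f_equal; ring.
Qed.

Lemma Cexp_RtoC (x : R) : Cexp (RtoC x) = RtoC (exp x).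
Proof. unfold Cexp, RtoC; simpl; rewrite cos_0, sin_0; f_equal; ring. Qed.

Lemma Cexp_neq_0 (z : C) : Cexp z <> 0.
Proof.
intros H; apply C1_nz; rewrite <- exp_0 at 1; rewrite <- Cexp_RtoC.
replace (RtoC 0) with (z + - z) by ring; rewrite Cexp_plus, H; ring.
Qed.

Definition gauss (z : C) (m : nat) : C :=
  NtoC (fact m) * Cexp (z * RtoC (ln (INR m))) / rising z (S m).

(** For m >= 1 this is (1 + 1/m)^z (m+1)/(z+m+1). Written with a difference of logarithms, it is the
    right quotient at m = 0 too, since the default value of [ln 0] cancels. *)
Definition gauss_ratio (z : C) (m : nat) : C :=
  Cexp (z * RtoC (ln (INR (S m)) - ln (INR m))) * NtoC (S m) / (z + NtoC (S m)).

Lemma gauss_neq_0 (z : C) (m : nat) : ~ is_Gamma_pole z -> gauss z m <> 0.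
Proof.
intros Hz; unfold gauss, Cdiv; repeat apply Cmult_neq_0.
- intros H; apply RtoC_inj in H; exact (INR_fact_neq_0 m H).
- apply Cexp_neq_0.
- intros H; apply C1_nz.
  rewrite <- (Cinv_r (rising z (S m))) by now apply rising_neq_0.
  rewrite H; ring.
Qed.

Lemma gauss_S (z : C) (m : nat) :
  ~ is_Gamma_pole z -> gauss z (S m) = gauss z m * gauss_ratio z m.
Proof.
intros Hz; unfold gauss, gauss_ratio.
replace (z * RtoC (ln (INR (S m))))
  with (z * RtoC (ln (INR m)) + z * RtoC (ln (INR (S m)) - ln (INR m)))
  by (rewrite RtoC_minus; ring).
rewrite Cexp_plus.
change (rising z (S (S m))) with (rising z (S m) * (z + NtoC (S m))).
rewrite fact_simpl; unfold NtoC at 1; rewrite mult_INR, RtoC_mult.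
fold (NtoC (S m)) (NtoC (fact m)).
field; split; [now apply not_pole_neq | now apply rising_neq_0].
Qed.

(** Both sides are ln y <= y - 1, taken at y = m/(m+1) and at y = (m+1)/m. *)
Lemma ln_step_bounds (m : nat) :
  (1 <= m)%nat ->
  (/ INR (S m) <= ln (INR (S m)) - ln (INR m) <= / INR m)%R.
Proof.
intros Hm.
assert (H1 : (1 <= INR m)%R) by (apply (le_INR 1); lia).
rewrite S_INR; set (x := INR m) in *.
assert (Hln : forall y, (0 < y)%R -> (ln y <= y - 1)%R).
{ intros y Hy; pose proof (exp_ineq1_le (ln y)); rewrite exp_ln in *; lra. }
split.
- pose proof (Hln (x / (x + 1))%R ltac:(apply Rdiv_lt_0_compat; lra)) as H.
  rewrite ln_div in H by lra.
  replace (/ (x + 1))%R with (- (x / (x + 1) - 1))%R by (field; lra); lra.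
- pose proof (Hln ((x + 1) / x)%R ltac:(apply Rdiv_lt_0_compat; lra)) as H.
  rewrite ln_div in H by lra.
  replace (/ x)%R with ((x + 1) / x - 1)%R by (field; lra); lra.
Qed.

(** With h = ln(m+1) - ln m and t = 1/(m+1), the quotient is exp(zh)/(1 + zt). Subtracting 1 leaves
    the numerator (exp(zh) - 1 - zh) + z(h - t), at most (4|z|^2 + |z|)/m^2. The assumption 2|z| <=
    m gives |zh| <= 1/2 and |1 + zt| >= 1/2, whence the factor 2. *)
Lemma gauss_ratio_bound (z : C) (m : nat) :
  ~ is_Gamma_pole z -> (1 <= m)%nat -> (2 * Cmod z <= INR m)%R ->
  (Cmod (gauss_ratio z m - 1) <= (8 * Cmod z ^ 2 + 2 * Cmod z) * / INR m ^ 2)%R.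
Proof.
intros Hz Hm Hlarge.
destruct (ln_step_bounds m Hm) as [Hlo Hhi].
unfold gauss_ratio; set (h := (ln (INR (S m)) - ln (INR m))%R) in *.
assert (H1 : (1 <= INR m)%R) by (apply (le_INR 1); lia).
assert (HS : INR (S m) = (INR m + 1)%R) by apply S_INR.
pose proof (Cmod_ge_0 z) as Hz0.
set (x := INR m) in *; set (t := (/ INR (S m))%R) in *.
assert (Ht : (0 < t)%R) by (apply Rinv_0_lt_compat; lra).
assert (Hx : (0 < / x)%R) by (apply Rinv_0_lt_compat; lra).
assert (Hxx : (x * / x = 1)%R) by (apply Rinv_r; lra).
assert (Htx : (t <= / x)%R) by lra.
assert (Hzx : (Cmod z * / x <= / 2)%R) by nra.
assert (Hgap : (/ x - t <= / x ^ 2)%R).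
{ unfold t; rewrite HS; rewrite <- pow_inv.
  assert (/ x - / (x + 1) = / x * / (x + 1))%R as -> by (field; lra).
  assert (/ (x + 1) <= / x)%R by (apply Rinv_le_contravar; lra).
  simpl; nra. }
assert (Hden : (/ 2 <= Cmod (1 + z * RtoC t))%R).
{ pose proof (Cmod_triangle (1 + z * RtoC t) (- (z * RtoC t))) as Htr.
  replace (1 + z * RtoC t + - (z * RtoC t)) with (RtoC 1) in Htr by ring.
  rewrite Cmod_opp, Cmod_1, Cmod_mult, Cmod_R, (Rabs_pos_eq t) in Htr by lra.
  nra. }
assert (Hd0 : 1 + z * RtoC t <> 0) by (intros H; rewrite H, Cmod_0 in Hden; lra).
assert (Hn0 : NtoC (S m) <> 0) by apply NtoC_S_neq_0.
assert (HtC : RtoC t = / NtoC (S m)) by (apply RtoC_inv; lra).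
replace (Cexp (z * RtoC h) * NtoC (S m) / (z + NtoC (S m)) - 1)
  with (((Cexp (z * RtoC h) - 1 - z * RtoC h) + z * RtoC (h - t)) *
        / (1 + z * RtoC t)).
2: { rewrite RtoC_minus, HtC in *; field; repeat split; trivial.
     now apply not_pole_neq. }
rewrite Cmod_mult, Cmod_inv by trivial.
assert (Hzh : Cmod (z * RtoC h) = (Cmod z * h)%R)
  by (rewrite Cmod_mult, Cmod_R, Rabs_pos_eq; lra).
assert (Hnum : (Cmod ((Cexp (z * RtoC h) - 1 - z * RtoC h) + z * RtoC (h - t))
                <= (4 * Cmod z ^ 2 + Cmod z) * / x ^ 2)%R).
{ eapply Rle_trans; [apply Cmod_triangle|].
  pose proof (Cexp_remainder (z * RtoC h)) as He; rewrite Hzh in He.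
  specialize (He ltac:(nra)).
  rewrite (Cmod_mult z), Cmod_R, Rabs_pos_eq by lra.
  assert (h ^ 2 <= / x ^ 2)%R by (rewrite <- pow_inv; simpl; nra).
  rewrite Rpow_mult_distr in He.
  pose proof (pow2_ge_0 (Cmod z)); nra. }
assert (Hinv : (/ Cmod (1 + z * RtoC t) <= 2)%R).
{ rewrite <- (Rinv_inv 2); apply Rinv_le_contravar; [lra | exact Hden]. }
pose proof (Cmod_ge_0 ((Cexp (z * RtoC h) - 1 - z * RtoC h) + z * RtoC (h - t))).
nra.
Qed.

Lemma gauss_cvg (z : C) :
  ~ is_Gamma_pole z -> Gamma z <> 0 /\ is_Clim (gauss z) (Gamma z).
Proof.
intros Hz.
destruct (INR_unbounded (2 * Cmod z)) as [N HN].
(* Starting at [S N] secures both m >= 1 and 2|z| <= m. *)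
destruct (ex_Clim_neq_0_of_ratio (gauss z) (gauss_ratio z)
            (8 * Cmod z ^ 2 + 2 * Cmod z) (S N)) as [l [Hl0 Hl]].
- intros m; now apply gauss_neq_0.
- intros m _; now apply gauss_S.
- intros m Hm; apply gauss_ratio_bound; trivial; [lia|].
  apply Rle_trans with (INR N); [lra | apply le_INR; lia].
- assert (HG : Gamma z = l) by exact (is_Clim_unique _ _ Hl).
  now rewrite HG.
Qed.

(** * Functional equations of Gamma and of the Pochhammer symbol *)

(** For M >= 1, the products at z + 1 and z satisfy gauss(z+1, M) = z gauss(z, M) / (1 + (z+1)/M),
    and the last factor tends to 1. The shift M = m + 1 makes exp(ln M) = M available. *)
Lemma Gamma_succ (z : C) : ~ is_Gamma_pole z -> Gamma (z + 1) = z * Gamma z.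
Proof.
intros Hz.
destruct (gauss_cvg z Hz) as [_ Hl].
assert (Hz1 := not_pole_succ z Hz).
destruct (gauss_cvg (z + 1) Hz1) as [_ Hl1].
apply (is_Clim_eq (fun m => gauss (z + 1) (m + 1)%nat));
  [now apply (is_Clim_incr_n (gauss (z + 1)) 1)|].
assert (Hq : is_Clim (fun m => / (1 + (z + 1) * / NtoC (S m)))
               (/ (1 + (z + 1) * 0))).
{ apply is_Clim_inv; [replace (1 + (z + 1) * 0) with (RtoC 1) by ring; apply C1_nz|].
  apply is_Clim_plus; [apply is_Clim_const|].
  apply is_Clim_mult; [apply is_Clim_const | apply is_Clim_inv_S]. }
replace (z * Gamma z) with (z * Gamma z * / (1 + (z + 1) * 0))
  by (field; replace (1 + (z + 1) * 0) with (RtoC 1) by ring; apply C1_nz).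
eapply is_Clim_ext;
  [|exact (is_Clim_mult _ _ _ _
       (is_Clim_mult _ _ _ _ (is_Clim_const z) (proj2 (is_Clim_incr_n _ 1 _) Hl)) Hq)].
intros m; simpl; rewrite Nat.add_1_r; unfold gauss.
replace ((z + 1) * RtoC (ln (INR (S m))))
  with (z * RtoC (ln (INR (S m))) + RtoC (ln (INR (S m)))) by ring.
rewrite Cexp_plus, Cexp_RtoC, exp_ln by (apply lt_0_INR; lia).
fold (NtoC (S m)).
change (rising (z + 1) (S (S m)))
  with (rising (z + 1) (S m) * (z + 1 + NtoC (S m))).
rewrite <- rising_shift.
assert (z <> 0).
{ pose proof (not_pole_neq z 0 Hz) as H; unfold NtoC in H; simpl in H.
  now rewrite Cplus_0_r in H. }
field; repeat split; trivial.
all: try now apply not_pole_neq.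
- now apply rising_neq_0.
- apply NtoC_S_neq_0.
Qed.

(** [x] and [x + 1] fall in different branches of [pochhammer] only at x = -1. When [x] is not a
    natural number, definedness says that [al + x] is no pole, as [Gamma_succ] requires. *)
Lemma pochhammer_succ (al x : C) :
  pochhammer_defined al x ->
  pochhammer al (x + 1) = pochhammer al x * (al + x).
Proof.
intros Hd.
destruct (classic (exists k : nat, x = NtoC k)) as [[k ->]|Hx].
- rewrite <- NtoC_S, !pochhammer_nat; reflexivity.
- destruct Hd as [Hd|Hd]; [contradiction|].
  assert (Hp : pochhammer al x = Gamma (al + x) / Gamma al)
    by (unfold pochhammer; destruct (excluded_middle_informative _); tauto).
  rewrite Hp.
  destruct (classic (exists k : nat, x + 1 = NtoC k)) as [[k Hk]|Hx1].
  + destruct k as [|k].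
    2: { exfalso; apply Hx; exists k; rewrite NtoC_S in Hk.
         replace x with (x + 1 - 1) by ring; rewrite Hk; ring. }
    (* Here [x = -1], and the claim is [Gamma al = (al - 1) Gamma (al - 1)]. *)
    assert (Ha : al = al + x + 1)
      by (rewrite <- Cplus_assoc, Hk; unfold NtoC; simpl; ring).
    assert (HG : Gamma al = (al + x) * Gamma (al + x))
      by (rewrite Ha at 1; now apply Gamma_succ).
    assert (HG0 : Gamma al <> 0)
      by (rewrite Ha; now apply gauss_cvg, not_pole_succ).
    rewrite Hk, pochhammer_nat; simpl.
    transitivity (Gamma al / Gamma al); [now field|].
    rewrite HG at 1; unfold Cdiv; ring.
  + assert (Hp1 : pochhammer al (x + 1) = Gamma (al + (x + 1)) / Gamma al)
      by (unfold pochhammer; destruct (excluded_middle_informative _); tauto).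
    rewrite Hp1, Cplus_assoc, Gamma_succ by assumption.
    unfold Cdiv; ring.
Qed.

(** * The certificate and the telescoping relation *)

Lemma p2_factor (a b c n : C) :
  p2 a b c n = - 4 * ((a + n) * (a + n + 1) * (b + n) * (b + n + 1)).
Proof. unfold p2; ring. Qed.

(** The last factor of [Rcert], named so that [field] can treat it as an atom. *)
Definition cert_poly (a b c n k : C) : C :=
  2 * a * b - c - a * c - b * c + c ^ 2 + 2 * a * k + 2 * b * k - 2 * c * k
   + 2 * k ^ 2 + n + 3 * a * n + 3 * b * n - 4 * c * n + 6 * k * n
   + 5 * n ^ 2.

(** The telescoping relation divided by F(n,k) (a+n)(a+n+1)(b+n)(b+n+1) and multiplied by
    A(A+1)B(B+1), where A = a+n+k and B = b+n+k. *)
Lemma cert_poly_identity (a b c n k : C) :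
  p1 a b c n - 4 * (a + n + k) * (a + n + k + 1) * (b + n + k) * (b + n + k + 1) =
  - cert_poly a b c n (k + 1) * (a + k + c) * (b + k + c)
  - cert_poly a b c n k * (a + n + k + 1) * (b + n + k + 1).
Proof. unfold p1, cert_poly; ring. Qed.

(** Turns definedness of all terms into nonzero denominators: [z + NtoC k] is a factor of
    [rising z (S k)]. *)
Lemma rising_factor_neq_0 (z : C) (k : nat) :
  (forall j, rising z j <> 0) -> z + NtoC k <> 0.
Proof.
intros H H0; apply (H (S k)); simpl; rewrite H0; ring.
Qed.

(** Both sides equal z(z+1)...(z+k+1). *)
Lemma rising_plus_2 (z : C) (k : nat) :
  z * (z + 1) * rising (z + 2) k = rising z k * (z + NtoC k) * (z + NtoC k + 1).
Proof.
replace (z + 2) with (z + 1 + 1) by ring.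
rewrite <- Cmult_assoc, rising_shift.
change (rising (z + 1) (S k)) with (rising (z + 1) k * (z + 1 + NtoC k)).
rewrite Cmult_assoc, rising_shift; simpl; ring.
Qed.

Section Telescoping.

Variables a b c n : C.
Hypothesis hF : forall k : nat, F_defined a b c n k.
Hypothesis hF2 : forall k : nat, F_defined a b c (n + 2) k.

Lemma rising_an (k : nat) : rising (a + n) k <> 0.
Proof. rewrite <- pochhammer_nat; apply (hF k). Qed.

Lemma rising_bn (k : nat) : rising (b + n) k <> 0.
Proof. rewrite <- pochhammer_nat; apply (hF k). Qed.

Lemma F_succ (k : nat) :
  F a b c n (S k) =
  - F a b c n k * ((a + NtoC k + c) * (b + NtoC k + c)) /
    ((a + n + NtoC k) * (b + n + NtoC k)).
Proof.
destruct (hF k) as [Ha [Hb _]].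
unfold F; rewrite !pochhammer_nat.
replace (NtoC (S k) + c) with (NtoC k + c + 1) by (rewrite NtoC_S; ring).
rewrite !pochhammer_succ by assumption; simpl.
pose proof (rising_an k); pose proof (rising_bn k).
pose proof (rising_factor_neq_0 _ k rising_an).
pose proof (rising_factor_neq_0 _ k rising_bn).
field; repeat split; assumption.
Qed.

Lemma F_plus_2 (k : nat) :
  F a b c (n + 2) k =
  F a b c n k * ((a + n) * (a + n + 1) * (b + n) * (b + n + 1)) /
    ((a + n + NtoC k) * (a + n + NtoC k + 1) *
     ((b + n + NtoC k) * (b + n + NtoC k + 1))).
Proof.
destruct (hF2 k) as [_ [_ [Ha2 Hb2]]].
unfold F; rewrite !pochhammer_nat in *.
rewrite !Cplus_assoc in *.
pose proof (rising_plus_2 (a + n) k) as Ea.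
pose proof (rising_plus_2 (b + n) k) as Eb.
pose proof (rising_an k); pose proof (rising_bn k).
pose proof (rising_factor_neq_0 _ k rising_an) as Ha.
pose proof (rising_factor_neq_0 _ k rising_bn) as Hb.
pose proof (rising_factor_neq_0 _ (S k) rising_an) as Ha1.
pose proof (rising_factor_neq_0 _ (S k) rising_bn) as Hb1.
rewrite NtoC_S, Cplus_assoc in Ha1, Hb1.
set (N := RtoC (-1) ^ k * pochhammer a (NtoC k + c) * pochhammer b (NtoC k + c)).
(* The fraction is expanded by the left sides of [Ea] and [Eb] above and their right sides below.
   Rewriting the numerator recovers the original; cancelling the shifted rising factorials gives the
   claim. *)
transitivity
  (N * ((a + n) * (a + n + 1) * rising (a + n + 2) k) *
       ((b + n) * (b + n + 1) * rising (b + n + 2) k) /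
   (rising (a + n + 2) k * rising (b + n + 2) k *
    (rising (a + n) k * (a + n + NtoC k) * (a + n + NtoC k + 1)) *
    (rising (b + n) k * (b + n + NtoC k) * (b + n + NtoC k + 1)))).
- rewrite Ea, Eb; field; repeat split; assumption.
- field; repeat split; assumption.
Qed.

Lemma G_telescopes (k : nat) :
  p1 a b c n * F a b c (n + 2) k + p2 a b c n * F a b c n k =
  G a b c n (S k) - G a b c n k.
Proof.
unfold G; rewrite F_plus_2, F_succ, p2_factor, NtoC_S.
unfold Rcert; fold (cert_poly a b c n (NtoC k)) (cert_poly a b c n (NtoC k + 1)).
pose proof (cert_poly_identity a b c n (NtoC k)) as E.
pose proof (rising_factor_neq_0 _ k rising_an) as Ha.
pose proof (rising_factor_neq_0 _ k rising_bn) as Hb.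
pose proof (rising_factor_neq_0 _ (S k) rising_an) as Ha1.
pose proof (rising_factor_neq_0 _ (S k) rising_bn) as Hb1.
rewrite NtoC_S, Cplus_assoc in Ha1, Hb1.
set (P := p1 a b c n) in *.
set (Q := cert_poly a b c n (NtoC k)) in *.
set (Q1 := cert_poly a b c n (NtoC k + 1)) in *.
set (f := F a b c n k).
set (x := NtoC k) in *.
replace (a + (x + 1) + n) with (a + n + x + 1) by ring.
replace (b + (x + 1) + n) with (b + n + x + 1) by ring.
replace (a + x + n) with (a + n + x) by ring.
replace (b + x + n) with (b + n + x) by ring.
set (A := a + n + x) in *; set (B := b + n + x) in *.
set (W := (a + n) * (a + n + 1) * (b + n) * (b + n + 1)).
(* The common factor [f * W] is isolated so that the left side of [E] appears literally. *)
transitivity (f * W * (P - 4 * A * (A + 1) * B * (B + 1)) / (A * (A + 1) * B * (B + 1))).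
- field; repeat split; assumption.
- rewrite E; unfold W; field; repeat split; assumption.
Qed.

Lemma sum_G_telescopes (m : nat) :
  p1 a b c n * sum_n (F a b c (n + 2)) m + p2 a b c n * sum_n (F a b c n) m =
  G a b c n (S m) - G a b c n 0.
Proof.
induction m as [|m IH].
- rewrite !sum_O; apply G_telescopes.
- rewrite !sum_Sn; unfold plus; simpl.
  replace (G a b c n (S (S m)) - G a b c n 0)
    with (G a b c n (S (S m)) - G a b c n (S m) + (G a b c n (S m) - G a b c n 0)) by ring.
  rewrite <- G_telescopes, <- IH; ring.
Qed.

End Telescoping.

(** * Passage to the limit *)

(** Numerator and denominator both have degree 2 in k. With t = 1/k, R(n,k) = W (2 + Lt + Mt^2) /
    ((1 + (a+n)t)(1 + (b+n)t)), which tends to 2W; the index [S k] keeps t meaningful. *)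
Lemma Rcert_cvg (a b c n : C) :
  (forall k, rising (a + n) k <> 0) -> (forall k, rising (b + n) k <> 0) ->
  exists l : C, is_Clim (fun k => Rcert a b c n (NtoC (S k))) l.
Proof.
intros Ha Hb.
set (t := fun k => / NtoC (S k)).
assert (Ht : is_Clim t 0) by apply is_Clim_inv_S.
assert (Haff : forall (u : nat -> C) (l y w : C), is_Clim u l ->
                 is_Clim (fun k => y + w * u k) (y + w * l)).
{ intros u l y w Hu; apply is_Clim_plus; [apply is_Clim_const|].
  apply is_Clim_mult; [apply is_Clim_const | exact Hu]. }
assert (H1 : forall w : C, 1 + w * 0 <> 0).
{ intros w; replace (1 + w * 0) with (RtoC 1) by ring; apply C1_nz. }
set (L := 2 * a + 2 * b - 2 * c + 6 * n).
set (M := 2 * a * b - c - a * c - b * c + c ^ 2 + n + 3 * a * n + 3 * b * n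
          - 4 * c * n + 5 * n ^ 2).
set (W := (a + n) * (1 + a + n) * (b + n) * (1 + b + n)).
eexists; eapply is_Clim_ext;
  [|exact (is_Clim_mult _ _ _ _
       (is_Clim_mult _ _ _ _ (is_Clim_const W)
          (is_Clim_mult _ _ _ _
             (is_Clim_inv _ _ (H1 (a + n)) (Haff _ _ 1 (a + n) Ht))
             (is_Clim_inv _ _ (H1 (b + n)) (Haff _ _ 1 (b + n) Ht))))
       (is_Clim_plus _ _ _ _ (Haff _ _ 2 L Ht)
          (is_Clim_mult _ _ _ _ (is_Clim_const M) (is_Clim_mult _ _ _ _ Ht Ht))))].
intros k; cbv beta; unfold t, Rcert, W, L, M.
pose proof (NtoC_S_neq_0 k).
pose proof (rising_factor_neq_0 _ (S k) Ha).
pose proof (rising_factor_neq_0 _ (S k) Hb).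
set (x := NtoC (S k)) in *.
replace (a + x + n) with (a + n + x) by ring.
replace (b + x + n) with (b + n + x) by ring.
field; repeat split; trivial.
Qed.

(** Connects convergence in C, as given by [ex_series], with the componentwise sum [CSeries]. *)
Lemma is_Clim_sum_n (u : nat -> C) :
  ex_series u -> is_Clim (sum_n u) (CSeries u).
Proof.
intros [l Hl].
assert (H : is_Clim (sum_n u) l) by (apply filterlim_is_Clim; exact Hl).
replace (CSeries u) with l; [exact H|].
assert (Hsum : forall m, sum_n u m =
          (sum_n (fun k => Re (u k)) m, sum_n (fun k => Im (u k)) m)).
{ induction m as [|m IH].
  - rewrite !sum_O; now destruct (u 0%nat).
  - rewrite !sum_Sn, IH; reflexivity. }
destruct H as [Hr Hi].
apply (is_lim_seq_ext _ (sum_n (fun k => Re (u k)))) in Hr;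
  [|intros m; now rewrite Hsum].
apply (is_lim_seq_ext _ (sum_n (fun k => Im (u k)))) in Hi;
  [|intros m; now rewrite Hsum].
unfold CSeries, Series.
rewrite (is_lim_seq_unique _ _ Hr), (is_lim_seq_unique _ _ Hi).
now destruct l.
Qed.

(** A term is the difference of consecutive partial sums, which share their limit. *)
Lemma is_Clim_term_0 (u : nat -> C) :
  ex_series u -> is_Clim (fun k => u (S k)) 0.
Proof.
intros Hu; pose proof (is_Clim_sum_n u Hu) as H.
replace (RtoC 0) with (CSeries u + - (1) * CSeries u) by ring.
eapply is_Clim_ext;
  [|apply is_Clim_plus;
    [exact (proj2 (is_Clim_incr_n _ 1 _) H)
    |exact (is_Clim_mult _ _ _ _ (is_Clim_const (- (1))) H)]].
intros m; simpl; rewrite Nat.add_1_r, sum_Sn; unfold plus; simpl; ring.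
Qed.

Theorem theorem2 (a b c n : C)
  (hF : forall k : nat, F_defined a b c n k)
  (hF2 : forall k : nat, F_defined a b c (n + 2) k)
  (hconv : ex_series (F a b c n))
  (hconv2 : ex_series (F a b c (n + 2)))
  (hp2 : p2 a b c n <> 0) :
  Fsum a b c n = g1 a b c n + g2 a b c n * Fsum a b c (n + 2).
Proof.
destruct (Rcert_cvg a b c n) as [l Hl].
{ now apply (rising_an a b c). }
{ now apply (rising_bn a b c). }
assert (HG : is_Clim (fun m => G a b c n (S m) - G a b c n 0) (l * 0 + - G a b c n 0)).
{ apply is_Clim_plus; [|apply is_Clim_const].
  apply is_Clim_mult; [exact Hl | now apply is_Clim_term_0]. }
(* The same sequence, read as a combination of partial sums, has a second expression for its
   limit. *)
assert (HS : is_Clim (fun m => G a b c n (S m) - G a b c n 0)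
    (p1 a b c n * Fsum a b c (n + 2) + p2 a b c n * Fsum a b c n)).
{ eapply is_Clim_ext; [intros m; apply sum_G_telescopes; assumption|].
  apply is_Clim_plus; apply is_Clim_mult;
    try apply is_Clim_const; now apply is_Clim_sum_n. }
(* Equating the limits expresses -G(n,0), the numerator of [g1], through the two sums. *)
pose proof (is_Clim_eq _ _ _ HG HS) as E; rewrite Cmult_0_r, Cplus_0_l in E.
unfold g1, g2; rewrite E; field; exact hp2.
Qed.
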